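(* Let $a_0,a_1,a_2$ be nonnegative integers and let $\chi=a_0-a_1+a_2$. For a random chain complex $0\leftarrow A_0\xleftarrow{d_1}A_1\xleftarrow{d_2}A_2\leftarrow 0$ with $A_i=\mathbb R^{a_i}$, almost surely \[(\beta_0,\beta_1,\beta_2)=\begin{cases} (a_0-a_1,\;0,\;a_2), & \text{if } a_0\ge a_1+a_2,\\ (a_0,\;0,\;a_2-a_1), & \text{if } a_2\ge a_0+a_1,\\ (0,\;a_1-a_0-a_2,\;0), & \text{if } a_1\ge a_0+a_2,\\ (\chi/2,\;0,\;\chi/2), & \text{if } a_2-a_1\le a_0\le a_1+a_2,\ a_1\le a_0+a_2,\ \chi \text{ even},\\ \big((\chi+1)/2,\,0,\,(\chi-1)/2\big)\ \text{or}\ \big((\chi-1)/2,\,0,\,(\chi+1)/2\big), & \text{if } a_2-a_1\le a_0\le a_1+a_2,\ a_1\le a_0+a_2,\ \chi \text{ odd}. \end{cases}\] Consequently, almost surely $\beta_0+\beta_1+\beta_2=|\chi|$.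
   Context: Model of a random chain complex: fix nonnegative integers $\vec a=(a_0,\dots,a_n)$ and $A_i=\mathbb R^{a_i}$. A sequence of linear maps $d_i:A_i\to A_{i-1}$ ($i=1,\dots,n$) is a point of $\mathbb R^N$, $N=\sum_{i=1}^n a_{i-1}a_i$ (matrix entries). Let $M(\vec a)\subseteq\mathbb R^N$ be the real affine algebraic variety of chain complexes, i.e.\ tuples with $d_i\circ d_{i+1}=0$ for all $i$; let $k$ be its Hausdorff dimension. Fix a bounded measurable probability density $f$ on $\mathbb R^N$ (e.g.\ standard Gaussian) with $\int_{M(\vec a)} f\,d\mathcal H^k>0$. For a subvariety $Y\subseteq M(\vec a)$ define $\Pr(Y)=\int_Y f\,d\mathcal H^k/\int_{M(\vec a)} f\,d\mathcal H^k$, where $\mathcal H^k$ is $k$-dimensional Hausdorff measure (equivalently, the limit as $\varepsilon\to0^+$ of the ratio of Lebesgue integrals of $f$ over $\varepsilon$-thickenings of $Y$ and of $M(\vec a)$). A random chain complex is a point of $M(\vec a)$ under this measure, and ''almost surely'' means with probability $1$ in this sense. Betti numbers: with $r_i=\operatorname{rank} d_i$ and $r_0=r_{n+1}=0$, $\beta_i=a_i-r_i-r_{i+1}=\dim H_i$. Here $n=2$. *)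

(* Defs.v *)
From HB Require Import structures.
From mathcomp Require Import all_boot all_order all_algebra.
From mathcomp Require Import all_classical all_reals all_analysis.
Set Implicit Arguments. Unset Strict Implicit. Unset Printing Implicit Defensive.
Import Order.TTheory GRing.Theory Num.Theory.
Local Open Scope classical_set_scope.
Local Open Scope ring_scope.

Section Hausdorff.
Variables (R : realType) (T : Type) (dist : T -> T -> R).

(* diameter of a set (ereal_sup of the set of distances; -oo for set0) *)
Definition hdiam (U : set T) : \bar R :=
  ereal_sup [set (dist x y)%:E | x in U & y in U].

(* contribution hdiam(U)^s of a covering set, with the convention that
   the empty set contributes 0 (so that H^0 is the counting measure) *)
Definition hterm (s : R) (U : set T) : \bar R :=
  if `[< U = set0 >] then 0%E else ((fine (hdiam U)) `^ s)%:E.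

Definition hausdorff_content (s delta : R) (A : set T) : \bar R :=
  ereal_inf [set (\sum_(i <oo) hterm s (F i))%E | F in
    [set F : (set T)^nat | A `<=` \bigcup_i F i /\
                           forall i, (hdiam (F i) <= delta%:E)%E]].

(* s-dimensional Hausdorff (outer) measure
   H^s(A) = lim_{delta -> 0+} H^s_delta(A) = sup_{delta > 0} H^s_delta(A)
   (normalisation constant omitted) *)
Definition hausdorff (s : R) (A : set T) : \bar R :=
  ereal_sup [set hausdorff_content s d A | d in [set d : R | 0 < d]].

Definition hausdorff_dim (A : set T) : \bar R :=
  ereal_inf [set s%:E | s in [set s : R | 0 <= s /\ hausdorff s A = 0%E]].

(* integral of a nonnegative function f over Y against H^s,
   int_Y f dH^s = int_0^oo H^s(Y `&` {f > t}) dt  (layer-cake formula) *)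
Definition hintegral (s : R) (Y : set T) (f : T -> R) : \bar R :=
  (\int[@lebesgue_measure R]_(t in `[0%R, +oo[%classic)
      hausdorff s (Y `&` [set x | (t < f x)%R]))%E.

End Hausdorff.

Section ChainComplex.
Variables (R : realType) (a0 a1 a2 : nat).

Definition cspace := ('M[R]_(a0, a1) * 'M[R]_(a1, a2))%type.

Definition Ndim : nat := (a0 * a1 + a1 * a2)%N.

Definition cc_dist (x y : cspace) : R :=
  Num.sqrt (\sum_(i < a0) \sum_(j < a1) (x.1 i j - y.1 i j) ^+ 2
          + \sum_(i < a1) \sum_(j < a2) (x.2 i j - y.2 i j) ^+ 2).

Definition eopen (U : set cspace) : Prop :=
  forall x, U x -> exists2 e : R, 0 < e & [set y | cc_dist x y < e] `<=` U.

Definition borel_fun (f : cspace -> R) : Prop :=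
  forall B : set R, measurable B -> <<s eopen >> (f @^-1` B).

Definition chain_complexes : set cspace := [set x | x.1 *m x.2 = 0].

Definition cdim : R := fine (hausdorff_dim cc_dist chain_complexes).

Definition Prob (f : cspace -> R) (Y : set cspace) : \bar R :=
  (hintegral cc_dist cdim Y f / hintegral cc_dist cdim chain_complexes f)%E.

Definition almost_surely (f : cspace -> R) (P : cspace -> Prop) : Prop :=
  Prob f [set x | chain_complexes x /\ P x] = 1%E.

(* Betti numbers beta_i = a_i - r_i - r_{i+1}, r_0 = r_3 = 0 *)
Definition betti (x : cspace) : int * int * int :=
  (a0%:Z - (\rank x.1)%:Z,
   a1%:Z - (\rank x.1)%:Z - (\rank x.2)%:Z,
   a2%:Z - (\rank x.2)%:Z).

End ChainComplex.

(* Main.v *)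
(* M is the finite union of the strata of complexes with ranks (r1, r2), and the
   stratum has dimension m(r1, r2) = r1 (a0 + a1 - r1) + r2 (a1 - r1 + a2 - r2).
   Almost surely the ranks maximise m, and the maximisers are exactly the pairs
   giving the listed Betti numbers.

   Upper bound: echelon forms write a stratum as a finite union of polynomial
   images of R^m, so it is H^s-null for s > m.  Lower bound: if M were H^k-null
   with k the maximal m, project it onto k coordinates that are free on a generic
   stratum; countably many translates of the projection cover R^k, so R^k would be
   H^k-null, hence R^N would be H^N-null, against the assumption that f has a
   positive H^N-integral.  Both bounds rest on the same remark: adding one
   coordinate to the metric turns an s-null set into an (s+1)-null set. *)

Require Import Defs.
From HB Require Import structures.
From mathcomp Require Import all_boot all_order all_algebra.
From mathcomp Require Import fingroup perm.
From mathcomp Require Import all_classical all_reals all_analysis.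
From mathcomp Require Import ring lra zify.
Set Implicit Arguments. Unset Strict Implicit. Unset Printing Implicit Defensive.
Import Order.TTheory GRing.Theory Num.Theory.
Local Open Scope classical_set_scope.
Local Open Scope ring_scope.

(** * Null sets for coverings by sets of prescribed size *)

Section Null.
Variable R : realType.
Implicit Types (s eps : R).

(* [D e x y] means that x and y are within distance e.  The sizes [e i] are kept
   positive so that covering sets can be subdivided at scale [e i]. *)
Definition null (T : Type) (D : R -> T -> T -> Prop) (s : R) (A : set T) :=
  forall eps : R, 0 < eps -> exists (P : pred nat) (F : nat -> set T) (e : nat -> R),
  [/\ forall i, 0 < e i,
      forall x, A x -> exists2 i, P i & F i x,
      forall i x y, F i x -> F i y -> D (e i) x y &
      (\sum_(0 <= i <oo | P i) (e i `^ s)%:E <= eps%:E)%E].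

Lemma null_countable (T : Type) (D : R -> T -> T -> Prop) (s : R) (A : set T) :
  (forall eps : R, 0 < eps ->
    exists (K : countType) (S : set K) (F : K -> set T) (e : K -> R),
    [/\ forall i, 0 < e i,
        forall x, A x -> exists2 i, S i & F i x,
        forall i x y, F i x -> F i y -> D (e i) x y &
        (\esum_(i in S) (e i `^ s)%:E <= eps%:E)%E]) ->
  null D s A.
Proof.
move=> H eps /H[K [S [F [e [e0 AF FD le]]]]].
exists (fun n => n \in pickle @` S),
  (fun n => if unpickle n is Some k then F k else set0),
  (fun n => if unpickle n is Some k then e k else 1); split.
- by move=> i; case: unpickle.
- move=> x /AF[k Sk Fk]; exists (pickle k); last by rewrite pickleK.
  by rewrite inE; exists k.
- by move=> i x y; case: unpickle => //= k; apply: FD.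
- rewrite nneseries_esum; last by move=> n _; rewrite lee_fin powR_ge0.
  rewrite (_ : [set x | _] = pickle @` S); last first.
    by apply/seteqP; split => n /=; rewrite inE.
  rewrite esum_image; last by move=> x y _ _; apply: (pcan_inj pickleK).
  by under eq_esum do rewrite pickleK.
Qed.

Lemma null_set0 (T : Type) (D : R -> T -> T -> Prop) s : null D s set0.
Proof.
move=> eps e0; exists xpred0, (fun=> set0), (fun=> 1); split => //.
by rewrite eseries_pred0// lee_fin ltW.
Qed.

Lemma null_bigcup (T : Type) (D : R -> T -> T -> Prop) s (A : nat -> set T) :
  (forall n, null D s (A n)) -> null D s (\bigcup_n A n).
Proof.
move=> nA; apply: null_countable => eps e0.
have /choice[C H] : forall n, exists C : pred nat * (nat -> set T) * (nat -> R),
    [/\ forall i, 0 < C.2 i,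
      forall x, A n x -> exists2 i, C.1.1 i & C.1.2 i x,
      forall i x y, C.1.2 i x -> C.1.2 i y -> D (C.2 i) x y &
      (\sum_(0 <= i <oo | C.1.1 i) (C.2 i `^ s)%:E <= (eps / (2 ^ n.+1)%:R)%:E)%E].
  move=> n; have p0 : 0 < eps / (2 ^ n.+1)%:R :> R.
    by rewrite divr_gt0// ltr0n expn_gt0.
  by have [P [F [e h]]] := nA n _ p0; exists (P, F, e).
pose P n := (C n).1.1; pose F n := (C n).1.2; pose e n := (C n).2.
exists (nat * nat)%type, ([set: nat] `*`` (fun n => [set i | P n i])),
  (fun k => F k.1 k.2), (fun k => e k.1 k.2); split.
- by move=> [n i]; have [h _ _ _] := H n; apply: h.
- move=> x [n _ Anx]; have [_ /(_ x Anx)[i Pi Fi] _ _] := H n.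
  by exists (n, i).
- by move=> [n i] x y /=; have [_ _ h _] := H n; apply: h.
- rewrite -(esum_esum (a := fun n i => (e n i `^ s)%:E)); last first.
    by move=> *; rewrite lee_fin powR_ge0.
  apply: (@le_trans _ _ (\esum_(n in [set: nat]) (eps / (2 ^ n.+1)%:R)%:E)%E).
    apply: le_esum => n _; rewrite -nneseries_esum; last first.
      by move=> *; rewrite lee_fin powR_ge0.
    by have [] := H n.
  rewrite -nneseries_esumT; last first.
    by move=> n; rewrite lee_fin divr_ge0// ltW.
  by apply: epsilon_trick0; rewrite ltW.
Qed.

Lemma null_bigcup_count (T : Type) (D : R -> T -> T -> Prop) s (K : countType)
    (A : K -> set T) :
  (forall k, null D s (A k)) -> null D s (\bigcup_k A k).
Proof.
move=> nA.
suff -> : \bigcup_k A k = \bigcup_n (if unpickle n is Some k then A k else set0).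
  by apply: null_bigcup => n; case: unpickle => //; apply: null_set0.
apply/seteqP; split => x [k _ Ax]; first by exists (pickle k) => //; rewrite pickleK.
by case: unpickle Ax => // k' ?; exists k'.
Qed.

(* Lipschitz images, for a correspondence [G] rather than a map so that the
   lemma also covers coordinate projections. *)
Lemma null_lip (T T' : Type) (D : R -> T -> T -> Prop) (D' : R -> T' -> T' -> Prop)
    s (A : set T) (A' : set T') (G : T -> T' -> Prop) (K : R) : 0 < K ->
  (forall y, A' y -> exists2 x, A x & G x y) ->
  (forall e x x' y y', 0 < e -> A x -> A x' -> A' y -> A' y' -> G x y -> G x' y' -> D e x x' ->
     D' (K * e) y y') ->
  null D s A -> null D' s A'.
Proof.
move=> K0 AG GD nA eps e0.
have Ks0 : 0 < K `^ s by rewrite powR_gt0.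
have [P [F [e [ep AF FD le]]]] := nA (eps / K `^ s) (divr_gt0 e0 Ks0).
exists P, (fun i => [set y | A' y /\ exists x, [/\ A x, F i x & G x y]]), (fun i => K * e i).
split.
- by move=> i; rewrite mulr_gt0.
- move=> y A'y; have [x Ax Gx] := AG y A'y; have [i Pi Fi] := AF x Ax.
  by exists i => //; split=> //; exists x.
- move=> i y y' [Ay [x [Ax Fx Gx]]] [Ay' [x' [Ax' Fx' Gx']]].
  by apply: (GD _ x x') => //; apply: FD.
- under eq_eseriesr do rewrite powRM ?EFinM ?(ltW K0) ?(ltW (ep _))//.
  rewrite nneseriesZl; last by move=> *; rewrite lee_fin powR_ge0.
  rewrite muleC -lee_pdivlMr -?EFinM//.

Qed.

Lemma null_sub (T : Type) (D D' : R -> T -> T -> Prop) s (A B : set T) :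
  B `<=` A -> (forall e x y, D e x y -> D' e x y) -> null D s A -> null D' s B.
Proof.
move=> BA DD; apply: (@null_lip _ _ _ _ _ _ _ eq 1) => //.
  by move=> y /BA; exists y.
by move=> e x x' y y' _ _ _ _ _ -> -> /DD; rewrite mul1r.
Qed.

(* Each covering set of size e is cut into O(1/e) slabs of width e. *)
Lemma null_coord (T : Type) (D : R -> T -> T -> Prop) s (A : set T) (h : T -> R) :
  0 < s -> null D s A ->
  null (fun e x y => D e x y /\ `|h x - h y| <= e) (s + 1) A.
Proof.
move=> s0 nA.
suff bd (L : nat) : null (fun e x y => D e x y /\ `|h x - h y| <= e) (s + 1)
    [set x | A x /\ `|h x| <= L%:R].
  apply: null_sub (null_bigcup bd) => // x Ax.
  by exists (Num.trunc `|h x|).+1 => //; split=> //; rewrite ltW// truncnS_gt.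
apply: null_countable => eps eps0.
set c : R := 2 * L%:R + 1.
have c0 : 0 < c by rewrite ltr_wpDl// mulr_ge0.
have d0 : 0 < Num.min 1 (eps / c) by rewrite lt_min ltr01 divr_gt0.
have [P [F [e [ep AF FD le]]]] := nA _ d0.
have le1 i : P i -> e i <= 1.
  move=> Pi; rewrite leNgt; apply/negP => e1.
  have : ((e i `^ s)%:E <= 1%:E)%E.
    apply: (@le_trans _ _ (\sum_(0 <= i <oo | P i) (e i `^ s)%:E)%E); last first.
      by apply: le_trans le _; rewrite lee_fin ge_min lexx.
    apply: le_trans (nneseries_lim_ge (u_ := fun i => (e i `^ s)%:E) i.+1 _); last first.
      by move=> *; rewrite lee_fin powR_ge0.
    rewrite big_mkcond big_nat_recr//= Pi leeDr// sume_ge0// => j _.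
    by case: ifP => // _; rewrite lee_fin powR_ge0.
  rewrite lee_fin leNgt => /negP; apply.
  have : 1 `^ s < e i `^ s by rewrite gt0_ltr_powR// ?nnegrE ltW.
  by rewrite powR1.
pose N i := (Num.trunc (2 * L%:R / e i)).+1.
exists (nat * nat)%type, ([set i | P i] `*`` (fun i => `I_(N i))),
  (fun k => [set x | [/\ F k.1 x, `|h x| <= L%:R &
      k.2%:R * e k.1 <= h x + L%:R < k.2.+1%:R * e k.1]]),
  (fun k => e k.1); split.
- by case.
- move=> x [/AF[i Pi Fi] hL].
  have hx : 0 <= h x + L%:R <= 2 * L%:R.
    by move: hL; rewrite ler_norml; lra.
  case/andP: hx => hx0 hx1.
  have q0 : 0 <= (h x + L%:R) / e i by rewrite divr_ge0// ltW.
  exists (i, Num.trunc ((h x + L%:R) / e i)) => /=.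
    split=> //=; rewrite /N ltnS; apply: le_truncn.
    by rewrite ler_pM2r ?invr_gt0.
  split=> //; rewrite -ler_pdivlMr// -ltr_pdivrMr//.
  exact: truncn_itv.
- move=> [i j] x y [/= Fx _ /andP[x1 x2]] [/= Fy _ /andP[y1 y2]]; split.
    exact: FD.
  by move: x2 y2; rewrite -natr1 mulrDl mul1r ler_norml => x2 y2; apply/andP; lra.
- rewrite -(esum_esum (a := fun i j => (e i `^ (s+1))%:E)); last first.
    by move=> *; rewrite lee_fin powR_ge0.
  apply: (@le_trans _ _ (\esum_(i in [set i | P i]) (c%:E * (e i `^ s)%:E)%E)).
    apply: le_esum => i Pi.
    rewrite esum_fset//; last by move=> *; rewrite lee_fin powR_ge0.
    rewrite -fsbig_ord sumEFin lee_fin big_const_ord iter_addr_0.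
    rewrite powRD ?(gt_eqF (ep i)) ?implybT// powRr1 ?(ltW (ep i))//.
    rewrite -mulr_natr -mulrA [leLHS]mulrC ler_wpM2r ?powR_ge0//.
    have : (Num.trunc (2 * L%:R / e i))%:R <= 2 * L%:R / e i.
      by have /andP[] := truncn_itv (divr_ge0 (mulr_ge0 (ler0n R 2) (ler0n R L)) (ltW (ep i))).
    rewrite ler_pdivlMr// => h1.
    rewrite /N -[_.+1%:R]natr1 mulrDr mulr1 mulrC.
    by rewrite lerD// le1.
  rewrite -nneseries_esum; last first.
    by move=> *; rewrite mule_ge0 ?lee_fin ?powR_ge0 ?ltW.
  rewrite nneseriesZl; last by move=> *; rewrite lee_fin powR_ge0.
  rewrite muleC -lee_pdivlMr// -EFinM.
  by apply: le_trans le _; rewrite lee_fin ge_min lexx orbT.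
Qed.

End Null.

(** * Null sets and the Hausdorff measure *)

Section HausdorffNull.
Variables (R : realType) (T : Type) (dist : T -> T -> R).
Hypothesis dist_ge0 : forall x y, 0 <= dist x y.

Let near (e : R) (x y : T) : Prop := dist x y <= e.

Lemma hterm_ge0 s U : (0 <= hterm dist s U)%E.
Proof. by rewrite /hterm; case: ifP => // _; rewrite lee_fin powR_ge0. Qed.

Lemma hdiam_ge U x y : U x -> U y -> ((dist x y)%:E <= hdiam dist U)%E.
Proof. by move=> Ux Uy; apply: ereal_sup_ubound; exists x => //; exists y. Qed.

Lemma hdiam_le U e : (forall x y, U x -> U y -> dist x y <= e) ->
  (hdiam dist U <= e%:E)%E.
Proof. by move=> h; apply: ge_ereal_sup => _ [x Ux [y Uy <-]]; rewrite lee_fin h. Qed.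

Lemma hdiam_ge0 U x : U x -> (0 <= hdiam dist U)%E.
Proof. by move=> Ux; apply: le_trans (hdiam_ge Ux Ux); rewrite lee_fin. Qed.

Lemma hdiam_fin U x e : U x -> (hdiam dist U <= e%:E)%E ->
  hdiam dist U = (fine (hdiam dist U))%:E.
Proof.
by move=> Ux le; rewrite fineK// ge0_fin_numE ?(hdiam_ge0 Ux)// (le_lt_trans le) ?ltry.
Qed.

Lemma content_ge0 s d A : (0 <= hausdorff_content dist s d A)%E.
Proof.
apply: le_ereal_inf_tmp => _ [F _ <-]; apply: nneseries_ge0 => *.
exact: hterm_ge0.
Qed.

Lemma hausdorff_ge0 s A : (0 <= hausdorff dist s A)%E.
Proof.
apply: le_trans (content_ge0 s 1 A) _; apply: ereal_sup_ubound.
by exists 1 => //=.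
Qed.

Lemma le_content s d (A B : set T) : A `<=` B ->
  (hausdorff_content dist s d A <= hausdorff_content dist s d B)%E.
Proof.
move=> AB; apply: le_ereal_inf => _ [F [BF Fd] <-]; exists F => //; split=> //.
exact: subset_trans AB BF.
Qed.

Lemma le_hausdorff s (A B : set T) : A `<=` B ->
  (hausdorff dist s A <= hausdorff dist s B)%E.
Proof.
move=> AB; apply: ge_ereal_sup => _ [d d0 <-].
by apply: le_trans (le_content _ _ AB) _; apply: ereal_sup_ubound; exists d.
Qed.

Lemma hausdorff_null s s' A : 0 <= s -> s <= s' -> 0 < s' ->
  hausdorff dist s A = 0%E -> null near s' A.
Proof.
move=> s0 ss s'0 H0 eps e0.
have : (hausdorff_content dist s 1 A < (eps / 2)%:E)%E.
  apply: (@le_lt_trans _ _ 0%E); last by rewrite lte_fin divr_gt0.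
  by rewrite -H0; apply: ereal_sup_ubound; exists 1 => //=.
move=> /ereal_inf_lt[_ [F [AF Fd] <-] lt].
pose eta i : R := (eps / 2 / (2 ^ i.+1)%:R) `^ (s'^-1).
have q0 i : 0 < eps / 2 / (2 ^ i.+1)%:R :> R.
  by rewrite !divr_gt0// ltr0n expn_gt0.
have eta0 i : 0 < eta i by rewrite powR_gt0.
pose e i := Num.max (fine (hdiam dist (F i))) (eta i).
have eP i : 0 < e i by rewrite lt_max eta0 orbT.
exists (fun i => `[< F i !=set0 >]), F, e; split => //.
- by move=> x /AF[i _ Fi]; exists i => //; apply/asboolP; exists x.
- move=> i x y Fx Fy; rewrite /near le_max; apply/orP; left.
  by rewrite -lee_fin -(hdiam_fin Fx (Fd i)) hdiam_ge.
apply: (@le_trans _ _ (\sum_(0 <= i <oo | `[< F i !=set0 >])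
    (hterm dist s (F i) + (eps / 2 / (2 ^ i.+1)%:R)%:E))%E).
  apply: lee_nneseries => [*|i /asboolP[x Fx]]; first by rewrite lee_fin powR_ge0.
  rewrite /hterm asboolF; last by move=> F0; rewrite F0 in Fx.
  rewrite -EFinD lee_fin /e.
  have d0 : 0 <= fine (hdiam dist (F i)) by rewrite fine_ge0// (hdiam_ge0 Fx).
  have d1 : fine (hdiam dist (F i)) <= 1 by rewrite -lee_fin -(hdiam_fin Fx (Fd i)) Fd.
  case: (leP (fine _) (eta i)) => _.
    rewrite /eta -powRrM mulVf ?gt_eqF// powRr1 ?(ltW (q0 i))//.
    by rewrite lerDr powR_ge0.
  apply: (@le_trans _ _ (fine (hdiam dist (F i)) `^ s)); last first.
    by rewrite lerDl ltW.
  have [->|dn0] := eqVneq (fine (hdiam dist (F i))) 0.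
    by rewrite powR0 ?gt_eqF// powR_ge0.
  by apply: ger_powR => //; rewrite lt0r dn0 d0.
apply: le_trans (epsilon_trick _ _ _) _; rewrite ?divr_ge0 ?(ltW e0)//.
  by move=> n; exact: hterm_ge0.
rewrite [eps in leRHS]splitr EFinD leeD2r//.
apply: le_trans (ltW lt).
rewrite eseries_mkcond; apply: lee_nneseries => [i _ _|i _]; case: ifP => // _; exact: hterm_ge0.
Qed.

Lemma null_content s d (A : set T) eps : 0 < s -> 0 < d -> null near s A -> 0 < eps ->
  exists F : nat -> set T, [/\ A `<=` \bigcup_i F i,
    forall i, (hdiam dist (F i) <= d%:E)%E &
    (\sum_(0 <= i <oo) hterm dist s (F i) <= eps%:E)%E].
Proof.
move=> s0 d0 nA eps0.
have m0 : 0 < Num.min (d `^ s) eps by rewrite lt_min powR_gt0.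
have [P [F [e [ep AF FD le]]]] := nA _ m0.
exists (fun i => if P i then F i else set0); split.
- by move=> x /AF[i Pi Fi]; exists i => //; rewrite Pi.
- move=> i; case: ifP => Pi; last by apply: hdiam_le.
  apply: hdiam_le => x y Fx Fy; apply: le_trans (FD _ _ _ Fx Fy) _.
  rewrite leNgt; apply/negP => de.
  have : ((e i `^ s)%:E <= (d `^ s)%:E)%E.
    apply: (@le_trans _ _ (\sum_(0 <= i <oo | P i) (e i `^ s)%:E)%E); last first.
      by apply: le_trans le _; rewrite lee_fin ge_min lexx.
    apply: le_trans (nneseries_lim_ge (u_ := fun i => (e i `^ s)%:E) i.+1 _); last first.
      by move=> *; rewrite lee_fin powR_ge0.
    rewrite big_mkcond big_nat_recr//= Pi leeDr// sume_ge0// => j _.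
    by case: ifP => // _; rewrite lee_fin powR_ge0.
  rewrite lee_fin leNgt => /negP; apply.
  by rewrite gt0_ltr_powR// ?nnegrE ltW.
- apply: (@le_trans _ _ (\sum_(0 <= i <oo | P i) (e i `^ s)%:E)%E); last first.
    by apply: le_trans le _; rewrite lee_fin ge_min lexx orbT.
  rewrite [leRHS]eseries_mkcond; apply: lee_nneseries => [*|i _]; first exact: hterm_ge0.
  case: ifP => Pi; last by rewrite /hterm asboolT.
  have [F0|/set0P[x Fx]] := eqVneq (F i) set0.
    by rewrite /hterm asboolT// lee_fin powR_ge0.
  rewrite /hterm asboolF; last by move=> F0; rewrite F0 in Fx.
  have le' : (hdiam dist (F i) <= (e i)%:E)%E by apply: hdiam_le; exact: FD.
  rewrite lee_fin ge0_ler_powR// ?nnegrE ?(ltW (ep i)) ?(ltW s0)//.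
    by rewrite fine_ge0// (hdiam_ge0 Fx).
  by rewrite -lee_fin -(hdiam_fin Fx le').
Qed.

Lemma nneseries_interleave_le (u v : nat -> \bar R) :
  (forall n, 0 <= u n)%E -> (forall n, 0 <= v n)%E ->
  (\sum_(0 <= i <oo) (if odd i then v i./2 else u i./2) <=
   \sum_(0 <= i <oo) u i + \sum_(0 <= i <oo) v i)%E.
Proof.
move=> u0 v0; pose w i := if odd i then v i./2 else u i./2.
change (\sum_(0 <= i <oo) w i <= \sum_(0 <= i <oo) u i + \sum_(0 <= i <oo) v i)%E.
have w0 n : (0 <= w n)%E by rewrite /w; case: (odd n).
have E n : (\sum_(0 <= i < n.*2) w i = \sum_(0 <= i < n) u i + \sum_(0 <= i < n) v i)%E.
  elim: n => [|n IH]; first by rewrite !big_geq// adde0.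
  rewrite doubleS 2?big_nat_recr//= IH !big_nat_recr//= /w /= odd_double uphalf_double doubleK.
  by rewrite -!addeA; congr (_ + _)%E; rewrite addeCA.
apply: lime_le; first by apply: is_cvg_nneseries => *.
near=> n.
apply: (@le_trans _ _ (\sum_(0 <= i < n.*2) w i)%E).
  by apply: lee_sum_nneg_natr => //; rewrite -addnn leq_addr.
by rewrite E leeD// nneseries_lim_ge.
Unshelve. all: by end_near.
Qed.

Lemma hausdorffU_null s (A B : set T) : 0 < s -> null near s B ->
  hausdorff dist s (A `|` B) = hausdorff dist s A.
Proof.
move=> s0 nB; apply/eqP; rewrite eq_le; apply/andP; split; last first.
  by apply: le_hausdorff; left.
apply: ge_ereal_sup => _ [d /= d0 <-].
apply: (@le_trans _ _ (hausdorff_content dist s d A)); last first.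
  by apply: ereal_sup_ubound; exists d.
apply: le_ereal_inf_tmp => _ [F [AF Fd] <-].
apply/lee_addgt0Pr => eps eps0.
have [G [BG Gd le]] := null_content s0 d0 nB eps0.
apply: (@le_trans _ _ (\sum_(0 <= i <oo) hterm dist s (F i) +
   \sum_(0 <= i <oo) hterm dist s (G i))%E); last by rewrite leeD2l.
apply: le_trans (nneseries_interleave_le _ _); last 2 first.
  - by move=> n; exact: hterm_ge0.
  - by move=> n; exact: hterm_ge0.
apply: ereal_inf_lbound; exists (fun i => if odd i then G i./2 else F i./2); last first.
  by congr (limn _); apply/funext => n; apply: eq_bigr => i _; case: ifP.
split; last by move=> i; case: ifP.
move=> x [/AF[i _ Fi]|/BG[i _ Gi]].
  by exists i.*2 => //; rewrite odd_double doubleK.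
by exists i.*2.+1 => //=; rewrite odd_double/= uphalf_double.
Qed.

Lemma hausdorff_set0 s : hausdorff dist s set0 = 0%E.
Proof.
apply/eqP; rewrite eq_le hausdorff_ge0 andbT.
apply: ge_ereal_sup => _ [d /= d0 <-].
apply: ereal_inf_lbound; exists (fun=> set0).
  by split=> // i; apply: hdiam_le.
by apply: eseries0 => i _ _; rewrite /hterm asboolT.
Qed.

Lemma null_hausdorff s A : 0 < s -> null near s A -> hausdorff dist s A = 0%E.
Proof. by move=> s0 nA; rewrite -[A]set0U hausdorffU_null// hausdorff_set0. Qed.

End HausdorffNull.

(** * Coordinates and locally Lipschitz images *)

Section Coordinates.
Variable R : realType.

Definition near_but (T : Type) (I : eqType) (c : I -> T -> R) (X : seq I)
    (e : R) (x y : T) : Prop :=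
  forall i, i \notin X -> `|c i x - c i y| <= e.

Lemma null_near_but (T : Type) (I : eqType) (c : I -> T -> R) X s (A : set T) :
  0 < s -> null (near_but c X) s A -> null (near_but c [::]) (s + (size X)%:R) A.
Proof.
elim: X s => [|i X IH] s s0 nA; first by rewrite addr0.
rewrite /= -natr1 [_ + 1]addrC addrA; apply: IH; first by rewrite addr_gt0.
apply: null_sub (null_coord (c i) s0 nA) => // e x y [h hi] j jX.
by have [->//|ji] := eqVneq j i; apply: h; rewrite inE negb_or ji.
Qed.

Lemma null_dim (T : Type) (I : finType) (c : I -> T -> R) s (A : set T) :
  #|I|%:R < s -> null (near_but c [::]) s A.
Proof.
move=> ls; rewrite (_ : s = s - #|I|%:R + (size (enum I))%:R); last first.
  by rewrite -cardE subrK.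
have s0 : 0 < s - #|I|%:R by rewrite subr_gt0.
apply: null_near_but => // eps e0.
exists (pred1 0), (fun=> setT), (fun=> eps `^ (s - #|I|%:R)^-1); split.
- by move=> _; rewrite powR_gt0.
- by move=> x _; exists 0.
- by move=> i x y _ _ j; rewrite mem_enum.
- rewrite nneseries_esum; last by move=> *; rewrite lee_fin powR_ge0.
  rewrite (_ : [set x | _] = [set 0]); last by apply/seteqP; split => x /= /eqP.
  rewrite esum_set1 ?lee_fin ?powR_ge0//.
  by rewrite -powRrM mulVf ?gt_eqF// powRr1// ltW.
Qed.

Definition ccoord a0 a1 a2 (i : ('I_a0 * 'I_a1) + ('I_a1 * 'I_a2))
    (x : cspace R a0 a1 a2) : R :=
  match i with inl p => x.1 p.1 p.2 | inr p => x.2 p.1 p.2 end.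

Lemma cc_dist_ge0 a0 a1 a2 (x y : cspace R a0 a1 a2) : 0 <= cc_dist x y.
Proof. exact: sqrtr_ge0. Qed.

Lemma cc_dist_near a0 a1 a2 (x y : cspace R a0 a1 a2) e :
  cc_dist x y <= e -> near_but (@ccoord a0 a1 a2) [::] e x y.
Proof.
move=> le i _; apply: le_trans le; rewrite -sqrtr_sqr; apply: ler_wsqrtr.
case: i => -[i j] /=.
- apply: (@le_trans _ _ (\sum_(i < a0) \sum_(j < a1) (x.1 i j - y.1 i j) ^+ 2)).
    rewrite (bigD1 i)//= (bigD1 j)//= -addrA lerDl addr_ge0//.
      by apply: sumr_ge0 => *; rewrite sqr_ge0.
    by apply: sumr_ge0 => *; apply: sumr_ge0 => *; rewrite sqr_ge0.
  by rewrite lerDl; apply: sumr_ge0 => *; apply: sumr_ge0 => *; rewrite sqr_ge0.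
- apply: (@le_trans _ _ (\sum_(i < a1) \sum_(j < a2) (x.2 i j - y.2 i j) ^+ 2)).
    rewrite (bigD1 i)//= (bigD1 j)//= -addrA lerDl addr_ge0//.
      by apply: sumr_ge0 => *; rewrite sqr_ge0.
    by apply: sumr_ge0 => *; apply: sumr_ge0 => *; rewrite sqr_ge0.
  by rewrite lerDr; apply: sumr_ge0 => *; apply: sumr_ge0 => *; rewrite sqr_ge0.
Qed.

Lemma near_cc_dist a0 a1 a2 (x y : cspace R a0 a1 a2) e : 0 <= e ->
  near_but (@ccoord a0 a1 a2) [::] e x y ->
  cc_dist x y <= (Ndim a0 a1 a2).+1%:R * e.
Proof.
move=> e0 h.
have E1 i j : (x.1 i j - y.1 i j) ^+ 2 <= e ^+ 2.
  by rewrite -real_normK ?num_real// lerXn2r ?nnegrE//; apply: (h (inl (i, j))).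
have E2 i j : (x.2 i j - y.2 i j) ^+ 2 <= e ^+ 2.
  by rewrite -real_normK ?num_real// lerXn2r ?nnegrE//; apply: (h (inr (i, j))).
have K0 : 0 <= (Ndim a0 a1 a2).+1%:R * e by rewrite mulr_ge0.
rewrite -[leRHS](ger0_norm K0) -sqrtr_sqr; apply: ler_wsqrtr.
apply: (@le_trans _ _ ((Ndim a0 a1 a2)%:R * e ^+ 2)).
  have S m n (u : 'I_m -> 'I_n -> R) : (forall i j, u i j <= e ^+ 2) ->
      \sum_(i < m) \sum_(j < n) u i j <= (m * n)%:R * e ^+ 2.
    move=> hu; rewrite natrM -mulrA mulr_natl -[X in _ *+ X]card_ord -sumr_const.
    apply: ler_sum => i _; rewrite mulr_natl -[X in _ *+ X]card_ord -sumr_const.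
    by apply: ler_sum.
  by rewrite natrD mulrDl lerD// S.
rewrite exprMn ler_wpM2r ?sqr_ge0// -natrX ler_nat.
by rewrite (@leq_trans (Ndim a0 a1 a2).+1)// -{1}[_.+1]muln1 leq_mul.
Qed.

Lemma null_cc_dist a0 a1 a2 s (A : set (cspace R a0 a1 a2)) :
  null (fun e x y => cc_dist x y <= e) s A <-> null (near_but (@ccoord a0 a1 a2) [::]) s A.
Proof.
split; first by apply: null_sub => // e x y; apply: cc_dist_near.
apply: (@null_lip _ _ _ _ _ _ _ _ eq (Ndim a0 a1 a2).+1%:R) => //.
  by move=> x; exists x.
move=> e x x' y y' e0 _ _ _ _ -> ->; apply: near_cc_dist.
exact: ltW.
Qed.

Section LocallyLipschitz.
Variable I : finType.
Implicit Types (h : (I -> R) -> R).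

Let near := near_but (fun (i : I) (x : I -> R) => x i) [::].
Let box (L : R) := [set x : I -> R | forall i, `|x i| <= L].

Definition loclip h := forall L, exists K, [/\ 0 <= K,
  forall x, box L x -> `|h x| <= K &
  forall e x y, 0 < e -> box L x -> box L y -> near e x y -> `|h x - h y| <= K * e].

Lemma loclip_cst a : loclip (fun=> a).
Proof.
move=> L; exists `|a|; split=> // e x y e0 _ _ _.
by rewrite subrr normr0 mulr_ge0// ltW.
Qed.

Lemma loclip_coord i : loclip (fun x => x i).
Proof.
move=> L; exists (Num.max 1 L); split; first by rewrite le_max ler01.
  by move=> x /(_ i) /le_trans; apply; rewrite le_max lexx orbT.
move=> e x y e0 _ _ /(_ i isT) /le_trans; apply.
by rewrite ler_peMl ?(ltW e0)// le_max lexx.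
Qed.

Lemma loclipD h1 h2 : loclip h1 -> loclip h2 -> loclip (fun x => h1 x + h2 x).
Proof.
move=> l1 l2 L; have [K1 [p1 b1 d1]] := l1 L; have [K2 [p2 b2 d2]] := l2 L.
exists (K1 + K2); split; first exact: addr_ge0.
  by move=> x bx; rewrite (le_trans (ler_normD _ _))// lerD ?b1 ?b2.
move=> e x y e0 bx bY nxy; rewrite opprD addrACA mulrDl.
by rewrite (le_trans (ler_normD _ _))// lerD ?d1 ?d2.
Qed.

Lemma loclipM h1 h2 : loclip h1 -> loclip h2 -> loclip (fun x => h1 x * h2 x).
Proof.
move=> l1 l2 L; have [K1 [p1 b1 d1]] := l1 L; have [K2 [p2 b2 d2]] := l2 L.
exists (K1 * K2 + K1 * K2); split; first by rewrite addr_ge0 ?mulr_ge0.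
  move=> x bx; rewrite normrM (@le_trans _ _ (K1 * K2))//.
    by rewrite ler_pM ?b1 ?b2.
  by rewrite lerDl mulr_ge0.
move=> e x y e0 bx bY nxy.
rewrite (_ : _ - _ = h1 x * (h2 x - h2 y) + (h1 x - h1 y) * h2 y); last by ring.
rewrite (le_trans (ler_normD _ _))// [leRHS]mulrDl lerD// normrM.
  by rewrite -mulrA ler_pM ?b1 ?d2.
by rewrite mulrAC ler_pM ?b2 ?d1.
Qed.

Lemma loclip_sum (J : Type) (r : seq J) (h : J -> (I -> R) -> R) :
  (forall j, loclip (h j)) -> loclip (fun x => \sum_(j <- r) h j x).
Proof.
move=> lh; elim: r => [|j r IH].
  by under eq_fun do rewrite big_nil; exact: loclip_cst.
by under eq_fun do rewrite big_cons; exact: loclipD.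
Qed.

Definition mxlip m n (M : (I -> R) -> 'M[R]_(m, n)) :=
  forall i j, loclip (fun x => M x i j).

Lemma mxlip_cst m n (M : 'M[R]_(m, n)) : mxlip (fun=> M).
Proof. by move=> i j; exact: loclip_cst. Qed.

Lemma mxlip_coord m n (k : 'I_m -> 'I_n -> I) :
  mxlip (fun x => \matrix_(i, j) x (k i j)).
Proof. by move=> i j; under eq_fun do rewrite mxE; exact: loclip_coord. Qed.

Lemma mxlipM m n p (M : (I -> R) -> 'M[R]_(m, n)) (N : (I -> R) -> 'M[R]_(n, p)) :
  mxlip M -> mxlip N -> mxlip (fun x => M x *m N x).
Proof.
move=> lM lN i j; under eq_fun do rewrite mxE.
by apply: loclip_sum => k; exact: loclipM.
Qed.

Lemma mxlip_row m n p (M : (I -> R) -> 'M[R]_(m, n)) (N : (I -> R) -> 'M[R]_(m, p)) :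
  mxlip M -> mxlip N -> mxlip (fun x => row_mx (M x) (N x)).
Proof.
move=> lM lN i j; under eq_fun do rewrite mxE.
by case: (fintype.split j) => k; [exact: lM|exact: lN].
Qed.

Lemma mxlip_col m n p (M : (I -> R) -> 'M[R]_(m, p)) (N : (I -> R) -> 'M[R]_(n, p)) :
  mxlip M -> mxlip N -> mxlip (fun x => col_mx (M x) (N x)).
Proof.
move=> lM lN i j; under eq_fun do rewrite mxE.
by case: (fintype.split i) => k; [exact: lM|exact: lN].
Qed.

Lemma null_range a0 a1 a2 s (g1 : (I -> R) -> 'M[R]_(a0, a1))
    (g2 : (I -> R) -> 'M[R]_(a1, a2)) :
  #|I|%:R < s -> mxlip g1 -> mxlip g2 ->
  null (near_but (@ccoord a0 a1 a2) [::]) s (range (fun x => (g1 x, g2 x))).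
Proof.
move=> Is l1 l2.
suff bd (n : nat) : null (near_but (@ccoord a0 a1 a2) [::]) s
    ((fun x => (g1 x, g2 x)) @` box n%:R).
  apply: null_sub (null_bigcup bd) => // _ [x _ <-].
  exists (Num.trunc (\sum_i `|x i|)).+1 => //; exists x => // i.
  rewrite ltW// (le_lt_trans _ (truncnS_gt _))// (bigD1 i)//= lerDl.
  exact: sumr_ge0.
have lc i : loclip (fun x => ccoord i (g1 x, g2 x)).
  by case: i => -[i j] /=; [exact: l1|exact: l2].
have /choice[K HK] := fun i => lc i n%:R.
have K0 i : 0 <= K i by have [] := HK i.
apply: (@null_lip _ _ _ near _ _ _ _ (fun x y => box n%:R x /\ y = (g1 x, g2 x))
  (1 + \sum_i K i)); last exact: null_dim Is.
- by rewrite ltr_pwDl// sumr_ge0.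
- by move=> _ [x bx <-]; exists x.
- move=> e x x' _ _ e0 _ _ _ _ [bx ->] [bx' ->] nx i _.
  have [_ _ lip] := HK i.
  apply: le_trans (lip _ _ _ e0 bx bx' nx) _; rewrite ler_wpM2r ?(ltW e0)//.
  by rewrite (bigD1 i)//= addrCA lerDl addr_ge0// sumr_ge0.
Qed.

End LocallyLipschitz.
End Coordinates.

(** * Charts of the rank strata *)

Section Strata.
Variable R : realType.

Lemma extend_injection r q (f : 'I_r -> 'I_(r + q)) : injective f ->
  exists sigma : 'S_(r + q), forall i, sigma (lshift q i) = f i.
Proof.
move=> fI.
pose s := [seq f i | i <- enum 'I_r] ++ enum [predC codom f].
have us : uniq s.
  rewrite cat_uniq map_inj_uniq// enum_uniq enum_uniq/= andbT.
  by apply/hasPn => x; rewrite mem_enum.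
have szs : size s = (r + q)%N.
  rewrite size_cat size_map -cardE card_ord -cardE.
  have := cardC (mem (codom f)); rewrite card_codom// !card_ord => /eqP.
  by rewrite eqn_add2l => /eqP ->.
have gI : injective (fun j : 'I_(r + q) => nth j s j).
  move=> j k /=; rewrite (set_nth_default k) ?szs// => /eqP.
  by rewrite nth_uniq ?szs// => /eqP/val_inj.
exists (perm gI) => i; rewrite permE /= nth_cat size_map -cardE card_ord ltn_ord.
by rewrite (nth_map i) ?nth_ord_enum// -cardE card_ord.
Qed.

Lemma row_free_echelon r q (Y : 'M[R]_(r, r + q)) : row_free Y ->
  exists (sigma : 'S_(r + q)) (U : 'M[R]_r) (V : 'M[R]_(r, q)),
    Y = U *m (row_mx 1%:M V *m perm_mx sigma).
Proof.
move=> fY; have fT : row_full Y^T by rewrite /row_full mxrank_tr.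
have [sigma E] := extend_injection (@fullrankfun_inj _ _ _ _ fT).
pose Z := col_perm sigma Y.
have LU : lsubmx Z \in unitmx.
  have -> : lsubmx Z = (rowsub (fullrankfun fT) Y^T)^T.
    by apply/matrixP => i j; rewrite !mxE E.
  by rewrite unitmx_tr fullrowsub_unit.
exists sigma, (lsubmx Z), (invmx (lsubmx Z) *m rsubmx Z).
rewrite mulmxA mul_mx_row mulmx1 mulKVmx// hsubmxK /Z col_permE -mulmxA -perm_mxM.
by rewrite mulVg perm_mx1 mulmx1.
Qed.

Lemma rank_factor m n r (d : 'M[R]_(m, n)) : \rank d = r ->
  exists (X : 'M[R]_(m, r)) (Y : 'M[R]_(r, n)), [/\ d = X *m Y, row_free Y & (Y <= d)%MS].
Proof.
move=> <-; exists (col_base d), (row_base d); split.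
- by rewrite mulmx_base.
- exact: row_base_free.
- by rewrite eq_row_base.
Qed.

Definition stratum a0 a1 a2 r1 r2 : set (cspace R a0 a1 a2) :=
  [set x | [/\ chain_complexes x, \rank x.1 = r1 & \rank x.2 = r2]].

Definition chart_index a0 r1 q r2 p : finType :=
  (('I_a0 * 'I_r1) + ('I_r1 * 'I_q) + ('I_q * 'I_r2) + ('I_r2 * 'I_p))%type.

Section Chart.
Variables a0 r1 q r2 p : nat.
Variables (sigma : 'S_(r1 + q)) (tau : 'S_(r2 + p)).
Let I := chart_index a0 r1 q r2 p.
Implicit Type t : I -> R.

Let X t := \matrix_(i < a0, j < r1) t (inl (inl (inl (i, j)))).
Let Y t := \matrix_(i < r1, j < q) t (inl (inl (inr (i, j)))).
Let Z t := \matrix_(i < q, j < r2) t (inl (inr (i, j))).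
Let W t := \matrix_(i < r2, j < p) t (inr (i, j)).

(* d1 = X [1 Y] and d2 = [-YZ; Z] [1 W] up to column permutations: [1 Y] and
   [1 W] are reduced echelon bases of the row spaces of d1 and d2. *)
Definition chart1 t := X t *m (row_mx 1%:M (Y t) *m perm_mx sigma).
Definition chart2 t := perm_mx (sigma^-1)%g *m col_mx ((- 1%:M) *m (Y t *m Z t)) (Z t)
  *m (row_mx 1%:M (W t) *m perm_mx tau).

Lemma chart1_lip : mxlip chart1.
Proof.
by do ?[apply: mxlipM|apply: mxlip_row|apply: mxlip_col|apply: mxlip_cst|apply: mxlip_coord].
Qed.

Lemma chart2_lip : mxlip chart2.
Proof.
by do ?[apply: mxlipM|apply: mxlip_row|apply: mxlip_col|apply: mxlip_cst|apply: mxlip_coord].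
Qed.

Lemma chart_onto (x : 'M[R]_(a0, r1)) (y : 'M[R]_(r1, q)) (z : 'M[R]_(q, r2)) (w : 'M[R]_(r2, p)) :
  exists t, [/\ X t = x, Y t = y, Z t = z & W t = w].
Proof.
exists (fun i => match i with
  | inl (inl (inl ij)) => x ij.1 ij.2
  | inl (inl (inr ij)) => y ij.1 ij.2
  | inl (inr ij) => z ij.1 ij.2
  | inr ij => w ij.1 ij.2 end).
by split; apply/matrixP => i j; rewrite mxE.
Qed.

End Chart.

Lemma stratum_charts a0 r1 q r2 p :
  stratum (a0 := a0) (a1 := r1 + q) (a2 := r2 + p) r1 r2 `<=`
  \bigcup_(st : 'S_(r1 + q) * 'S_(r2 + p)) range (fun t =>
    (chart1 (a0 := a0) (r2 := r2) (p := p) st.1 t, chart2 (a0 := a0) st.1 st.2 t)).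
Proof.
move=> [d1 d2] [/= dd rk1 rk2].
have [X1 [Y1 [E1 fY1 Y1d]]] := rank_factor rk1.
have [sigma [U [V EY]]] := row_free_echelon fY1.
have [X2 [Y2 [E2 fY2 _]]] := rank_factor rk2.
have [tau [U2 [W EY2]]] := row_free_echelon fY2.
have U_unit : U \in unitmx.
  rewrite -row_free_unit; move: fY1; rewrite EY /row_free => /eqP h.
  by rewrite eqn_leq rank_leq_row -{1}h mxrankM_maxl.
have YX2 : Y1 *m X2 = 0.
  have /submxP[C EC] := Y1d.
  apply: (row_free_inj fY2); rewrite mul0mx -mulmxA -E2 EC -mulmxA.
  by move: dd; rewrite /chain_complexes/= => ->; rewrite mulmx0.
pose Z := perm_mx sigma *m (X2 *m U2).
have VZ : usubmx Z + V *m dsubmx Z = 0.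
  rewrite -[usubmx Z]mul1mx -mul_row_col vsubmxK /Z.
  have : U *m (row_mx 1%:M V *m perm_mx sigma) *m X2 *m U2 = 0.
    by rewrite -EY YX2 mul0mx.
  move=> /(congr1 (mulmx (invmx U))); rewrite mulmx0 -!mulmxA mulKmx//.
have [t [tx ty tz tw]] := chart_onto (X1 *m U) V (dsubmx Z) W.
exists (sigma, tau) => //; exists t => //=.
rewrite /chart1 /chart2 tx ty tz tw; congr pair.
  by rewrite -mulmxA -EY.
have -> : - 1%:M *m (V *m dsubmx Z) = usubmx Z.
  by rewrite mulNmx mul1mx; apply/eqP; rewrite eq_sym -addr_eq0 VZ.
rewrite vsubmxK /Z [perm_mx _ *m (perm_mx _ *m _)]mulmxA -perm_mxM mulVg.
by rewrite perm_mx1 mul1mx -mulmxA -EY2.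
Qed.

Definition stratum_dim a0 a1 a2 r1 r2 : nat :=
  (r1 * (a0 + a1 - r1) + r2 * (a1 - r1 + a2 - r2))%N.

Lemma null_stratum a0 a1 a2 r1 r2 s :
  (stratum_dim a0 a1 a2 r1 r2)%:R < s ->
  null (near_but (@ccoord R a0 a1 a2) [::]) s (@stratum a0 a1 a2 r1 r2).
Proof.
have [r1a1|a1r1] := leqP r1 a1; last first.
  move=> _; rewrite (_ : stratum _ _ = set0); first exact: null_set0.
  apply/seteqP; split => // x [_ rk _]; move: (rank_leq_col x.1).
  by rewrite rk leqNgt a1r1.
have [r2a2|a2r2] := leqP r2 a2; last first.
  move=> _; rewrite (_ : stratum _ _ = set0); first exact: null_set0.
  apply/seteqP; split => // x [_ _ rk]; move: (rank_leq_col x.2).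
  by rewrite rk leqNgt a2r2.
have [q Eq] : exists q, a1 = (r1 + q)%N by exists (a1 - r1)%N; rewrite subnKC.
have [p Ep] : exists p, a2 = (r2 + p)%N by exists (a2 - r2)%N; rewrite subnKC.
subst a1 a2 => ls;
apply: (@null_sub _ _ (near_but (@ccoord R _ _ _) [::]) _ _ _ _
  (@stratum_charts a0 r1 q r2 p)) => //.
apply: null_bigcup_count => -[sigma tau]; apply: null_range.
- apply: le_lt_trans ls; rewrite ler_nat !card_sum !card_prod !card_ord /stratum_dim.
  nia.
- exact: chart1_lip.
- exact: chart2_lip.
Qed.

End Strata.

(** * Lower bound for the dimension of M *)

Section LowerBound.
Variable R : realType.

Lemma unit_translate m n (A : 'M[R]_m) (E : 'M[R]_n) :
  exists t : nat, (A + t%:R%:M \in unitmx) && (E + t%:R%:M \in unitmx).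
Proof.
have unitE k (B : 'M[R]_k) a : ~~ root (char_poly B) (- a) -> B + a%:M \in unitmx.
  rewrite -eigenvalue_root_char /eigenvalue /eigenspace negbK raddfN opprK.
  by rewrite -row_free_unit -kermx_eq0.
pose p := char_poly A * char_poly E.
have p0 : p != 0 by rewrite mulf_neq0// monic_neq0// char_poly_monic.
pose rs := [seq - (t%:R : R) | t <- iota 0 (size p)].
have : ~~ all (root p) rs.
  apply/negP => /(max_poly_roots p0); rewrite size_map size_iota ltnn => h.
  apply: (Bool.diff_false_true (h _)); rewrite map_inj_uniq ?iota_uniq//.
  by move=> i j /oppr_inj /eqP; rewrite eqr_nat => /eqP.
rewrite all_map => /allPn[t _ /=]; rewrite rootM negb_or => /andP[rA rE].
by exists t; rewrite !unitE.
Qed.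

Variables g1 p0 g2 q p2 : nat.
Let a0 := (g1 + p0)%N.
Let a1 := (g1 + (g2 + q))%N.
Let a2 := (g2 + p2)%N.

(* On the generic part of M, the coordinates in this list are determined by
   all the other ones. *)
Definition dependent_coords : seq ('I_a0 * 'I_a1 + 'I_a1 * 'I_a2) :=
  [seq inl (rshift g1 i, rshift g1 j) | i <- enum 'I_p0, j <- enum 'I_(g2 + q)] ++
  [seq inr (lshift (g2 + q) i, j) | i <- enum 'I_g1, j <- enum 'I_a2] ++
  [seq inr (rshift g1 (rshift g2 i), rshift g2 j) | i <- enum 'I_q, j <- enum 'I_p2].

Lemma size_dependent_coords :
  size dependent_coords = (p0 * (g2 + q) + (g1 * a2 + q * p2))%N.
Proof. by rewrite !size_cat !size_allpairs -!cardE !card_ord. Qed.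

Let v : cspace R a0 a1 a2 :=
  (block_mx 1%:M 0 0 0, col_mx 0 (block_mx 1%:M 0 0 0)).

Lemma chain_complexes_project (y : cspace R a0 a1 a2) :
  exists (t : nat) (x : cspace R a0 a1 a2), chain_complexes x /\
  forall i, i \notin dependent_coords ->
    ccoord i x = ccoord i y + t%:R * ccoord i v.
Proof.
case: y => y1 y2.
rewrite -[y1](@submxK _ g1 p0 g1 (g2 + q)) -[y2](@vsubmxK _ g1 (g2 + q)).
rewrite -[dsubmx y2](@submxK _ g2 q g2 p2).
set A := ulsubmx y1; set B := ursubmx y1; set C := dlsubmx y1.
set E := ulsubmx (dsubmx y2); set F := ursubmx (dsubmx y2); set G := dlsubmx (dsubmx y2).
have [t /andP[UA UE]] := unit_translate A E.
set A' := A + _ in UA; set E' := E + _ in UE.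
pose Z := block_mx E' F G (G *m invmx E' *m F).
exists t, (block_mx A' B C (C *m invmx A' *m B), col_mx (- (invmx A' *m B *m Z)) Z).
split.
  rewrite /chain_complexes /= mul_block_col -[RHS]col_mx0; congr col_mx.
    by rewrite mulmxN !mulmxA mulmxV// mul1mx addNr.
  by rewrite mulmxN !mulmxA addNr.
case=> -[i j]; rewrite /dependent_coords !mem_cat !negb_or => /and3P[n1 n2 n3].
- have [i' Ei|i' Ei] := split_ordP i; have [j' Ej|j' Ej] := split_ordP j; subst i j.
  + by rewrite /= !block_mxEul !mxE mulr_natr.
  + by rewrite /= !block_mxEur !mxE mulr0 addr0.
  + by rewrite /= !block_mxEdl !mxE mulr0 addr0.
  + by case/negP: n1; apply/allpairsP; exists (i', j'); rewrite !mem_enum.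
- have [i' Ei|i' Ei] := split_ordP i; subst i.
    by case/negP: n2; apply/allpairsP; exists (i', j); rewrite !mem_enum.
  rewrite /= !col_mxEd.
  have [k Ek|k Ek] := split_ordP i'; have [j' Ej|j' Ej] := split_ordP j; subst i' j.
  + by rewrite /= !block_mxEul !mxE mulr_natr.
  + by rewrite /= !block_mxEur !mxE mulr0 addr0.
  + by rewrite /= !block_mxEdl !mxE mulr0 addr0.
  + by case/negP: n3; apply/allpairsP; exists (k, j'); rewrite !mem_enum.
Qed.

Lemma null_chain_complexes_setT : (0 < stratum_dim a0 a1 a2 g1 g2)%N ->
  null (near_but (@ccoord R a0 a1 a2) [::]) (stratum_dim a0 a1 a2 g1 g2)%:R
    (@chain_complexes R a0 a1 a2) ->
  null (near_but (@ccoord R a0 a1 a2) [::]) (Ndim a0 a1 a2)%:R setT.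
Proof.
move=> k0 nM.
have -> : Ndim a0 a1 a2 = (stratum_dim a0 a1 a2 g1 g2 + size dependent_coords)%N.
  by rewrite size_dependent_coords /stratum_dim /Ndim /a0 /a1 /a2; nia.
rewrite natrD; apply: null_near_but; first by rewrite ltr0n.
pose G (t : nat) (x y : cspace R a0 a1 a2) := forall i, i \notin dependent_coords ->
  ccoord i x = ccoord i y + t%:R * ccoord i v.
suff nB t : null (near_but (@ccoord R a0 a1 a2) dependent_coords)
    (stratum_dim a0 a1 a2 g1 g2)%:R [set y | exists2 x, chain_complexes x & G t x y].
  apply: null_sub (null_bigcup nB) => // y _.
  by have [t [x [Mx Gx]]] := chain_complexes_project y; exists t => //; exists x.
apply: (@null_lip _ _ _ _ _ _ _ _ (G t) 1 _ _ _ nM) => //.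
move=> e x x' y y' _ _ _ _ _ Gx Gx' nx i iX.
move: (nx i isT); rewrite mul1r (Gx _ iX) (Gx' _ iX).
by rewrite (_ : _ - _ = ccoord i y - ccoord i y')//; ring.
Qed.

End LowerBound.

(** * Strata of maximal dimension *)

Section FeasibleRanks.
Variables a0 a1 a2 : nat.

Definition feasible r1 r2 := [&& r1 <= a0, r1 + r2 <= a1 & r2 <= a2]%N.

Lemma feasibleP r1 r2 : feasible r1 r2 -> exists x t y,
  [/\ a0 = r1 + x, a1 = r1 + r2 + t & a2 = r2 + y]%N.
Proof.
by move=> /and3P[? ? ?]; exists (a0 - r1)%N, (a1 - (r1 + r2))%N, (a2 - r2)%N; rewrite !subnKC.
Qed.

Lemma stratum_dimE r1 r2 x t y :
  a0 = (r1 + x)%N -> a1 = (r1 + r2 + t)%N -> a2 = (r2 + y)%N ->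
  stratum_dim a0 a1 a2 r1 r2 = (r1 * (r1 + r2 + t + x) + r2 * (r2 + t + y))%N.
Proof. by move=> -> -> ->; rewrite /stratum_dim; congr (_ * _ + _ * _)%N; lia. Qed.

End FeasibleRanks.

Section Generic.
Variables (R : realType) (a0 a1 a2 : nat).
Local Notation M := (@chain_complexes R a0 a1 a2).
Local Notation dist := (@cc_dist R a0 a1 a2).
Local Notation k := (@cdim R a0 a1 a2).
Local Notation dimS := (stratum_dim a0 a1 a2).
Local Notation feasible := (feasible a0 a1 a2).
Implicit Types f : cspace R a0 a1 a2 -> R.

Lemma null_setT_hintegral f : (0 < Ndim a0 a1 a2)%N ->
  null (near_but (@ccoord R a0 a1 a2) [::]) (Ndim a0 a1 a2)%:R setT ->
  hintegral dist (Ndim a0 a1 a2)%:R setT f = 0%E.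
Proof.
move=> N0 /null_cc_dist nT; rewrite /hintegral.
have N0' : 0 < (Ndim a0 a1 a2)%:R :> R by rewrite ltr0n.
rewrite (eq_integral (cst 0%E)) ?integral0// => t _ /=.
apply/eqP; rewrite eq_le hausdorff_ge0 andbT.
rewrite -[leRHS](null_hausdorff (@cc_dist_ge0 _ _ _ _) N0' nT).
by apply: le_hausdorff; last by [].
Qed.

Lemma cdim_ge f r1 r2 : (0 < hintegral dist (Ndim a0 a1 a2)%:R setT f)%E ->
  feasible r1 r2 -> (dimS r1 r2)%:R <= k.
Proof.
move=> f0 /feasibleP[x [t [y [E0 E1 E2]]]].
set S := [set s%:E | s in [set s : R | 0 <= s /\ hausdorff dist s M = 0%E]].
have lb : ((dimS r1 r2)%:R%:E <= ereal_inf S)%E.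
  apply: le_ereal_inf_tmp => _ [s [s0 Hs] <-]; rewrite lee_fin leNgt.
  apply/negP => slt.
  have k0 : (0 < dimS r1 r2)%N by rewrite -(ltr0n R) (le_lt_trans s0).
  have /null_cc_dist nM : null (fun e x y => dist x y <= e) (dimS r1 r2)%:R M.
    apply: (hausdorff_null (@cc_dist_ge0 _ _ _ _) s0 (ltW slt)) => //.
    by rewrite ltr0n.
  have N0 : (0 < Ndim a0 a1 a2)%N.
    by rewrite (leq_trans k0)// (stratum_dimE E0 E1 E2) /Ndim E0 E1 E2; nia.
  have nT : null (near_but (@ccoord R a0 a1 a2) [::]) (Ndim a0 a1 a2)%:R setT.
    by move: k0 nM; rewrite E0 E1 E2 -addnA; exact: null_chain_complexes_setT.
  by move: f0; rewrite null_setT_hintegral// ltxx.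
have ub : (ereal_inf S <= (Ndim a0 a1 a2).+1%:R%:E)%E.
  apply: ereal_inf_lbound; exists (Ndim a0 a1 a2).+1%:R => //; split=> //.
  apply: (null_hausdorff (@cc_dist_ge0 _ _ _ _)); first by rewrite ltr0n.
  apply/null_cc_dist/null_dim.
  by rewrite ltr_nat card_sum !card_prod !card_ord.
rewrite -lee_fin /cdim /hausdorff_dim -/S fineK//.
rewrite ge0_fin_numE ?(le_lt_trans ub) ?ltry//.
by apply: le_trans lb; rewrite lee_fin.
Qed.

Lemma chain_complex_feasible (x : cspace R a0 a1 a2) :
  M x -> feasible (\rank x.1) (\rank x.2).
Proof.
move=> Mx; apply/and3P; split; [exact: rank_leq_row| |exact: rank_leq_col].
exact: mulmx0_rank_max.
Qed.

Lemma almost_surely_generic f (P : cspace R a0 a1 a2 -> Prop) g1 g2 :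
  (0 < hintegral dist (Ndim a0 a1 a2)%:R setT f)%E ->
  (0 < hintegral dist k M f < +oo)%E ->
  feasible g1 g2 ->
  (forall x, M x -> ~ P x -> (dimS (\rank x.1) (\rank x.2) < dimS g1 g2)%N) ->
  almost_surely f P.
Proof.
move=> f0 /andP[fM0 fMoo] feas bad.
have gk := cdim_ge f0 feas.
pose B := [set x | M x /\ ~ P x].
have E : hintegral dist k [set x | M x /\ P x] f = hintegral dist k M f.
  apply: eq_integral => t _; set U := [set x | t < f x].
  have MU : M `&` U = ([set x | M x /\ P x] `&` U) `|` (B `&` U).
    apply/seteqP; split => [x [Mx Ux]|x [[[Mx _] Ux]|[[Mx _] Ux]]]; [|by []..].
    by have [Px|nPx] := pselect (P x); [left|right].
  have [k0|k0] := ltP 0 k; last first.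
    rewrite MU (_ : B `&` U = set0) ?setU0//.
    apply/seteqP; split => // x [[Mx nPx] _] /=.
    have := bad x Mx nPx; rewrite -(ltr_nat R) => lt.
    by have := le_lt_trans (ler0n R _) (lt_le_trans lt (le_trans gk k0)); rewrite ltxx.
  rewrite MU (hausdorffU_null (@cc_dist_ge0 _ _ _ _) _ k0)//.
  apply/null_cc_dist.
  pose A (r : nat * nat) :=
    if (dimS r.1 r.2 < dimS g1 g2)%N then @stratum R a0 a1 a2 r.1 r.2 else set0.
  apply: (@null_sub _ _ (near_but (@ccoord R a0 a1 a2) [::]) _ _ (\bigcup_r A r)) => //.
    move=> x [[Mx nPx] _]; exists (\rank x.1, \rank x.2) => //=.
    by rewrite /A /= bad.
  apply: null_bigcup_count => r; rewrite /A; case: ifP => [lt|_]; last exact: null_set0.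
  by apply: null_stratum; rewrite (lt_le_trans _ gk)// ltr_nat.
rewrite /almost_surely /Prob E divee ?gt_eqF//.
by rewrite gt0_fin_numE.
Qed.

End Generic.

Section MaximalStrata.
Variables a0 a1 a2 : nat.
Local Notation feasible := (feasible a0 a1 a2).
Local Notation dimS := (stratum_dim a0 a1 a2).

Lemma dim_lt_left r1 r2 : (a1 + a2 <= a0)%N -> feasible r1 r2 ->
  (r1, r2) <> (a1, 0) -> (dimS r1 r2 < dimS a1 0)%N.
Proof.
move=> le /feasibleP[x [t [y [E0 E1 E2]]]] ne.
rewrite (stratum_dimE E0 E1 E2) (@stratum_dimE a0 a1 a2 a1 0 (a0 - a1) 0 a2); try lia.
have {ne} : (0 < r2 + t)%N by rewrite lt0n; apply/eqP => h; apply: ne; congr pair; lia.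
have [w Ew] : exists w, x = (2 * r2 + t + y + w)%N by exists (x - (2 * r2 + t + y))%N; lia.
have -> : (a0 - a1 = r2 + y + w)%N by lia.
rewrite E1 Ew; nia.
Qed.

Lemma dim_lt_right r1 r2 : (a0 + a1 <= a2)%N -> feasible r1 r2 ->
  (r1, r2) <> (0, a1) -> (dimS r1 r2 < dimS 0 a1)%N.
Proof.
move=> le /feasibleP[x [t [y [E0 E1 E2]]]] ne.
rewrite (stratum_dimE E0 E1 E2) (@stratum_dimE a0 a1 a2 0 a1 a0 0 (a2 - a1)); try lia.
have {ne} : (0 < r1 + t)%N by rewrite lt0n; apply/eqP => h; apply: ne; congr pair; lia.
have [w Ew] : exists w, y = (2 * r1 + t + x + w)%N by exists (y - (2 * r1 + t + x))%N; lia.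
have -> : (a2 - a1 = r1 + x + w)%N by lia.
rewrite E1 Ew; nia.
Qed.

Lemma dim_lt_middle r1 r2 : (a0 + a2 <= a1)%N -> feasible r1 r2 ->
  (r1, r2) <> (a0, a2) -> (dimS r1 r2 < dimS a0 a2)%N.
Proof.
move=> le /feasibleP[x [t [y [E0 E1 E2]]]] ne.
rewrite (stratum_dimE E0 E1 E2) (@stratum_dimE a0 a1 a2 a0 a2 0 (a1 - (a0 + a2)) 0); try lia.
have {ne} : (0 < x + y)%N by rewrite lt0n; apply/eqP => h; apply: ne; congr pair; lia.
have [w Ew] : exists w, t = (x + y + w)%N by exists (t - (x + y))%N; lia.
have -> : (a1 - (a0 + a2) = w)%N by lia.
rewrite E0 E2 Ew; nia.
Qed.

(* On the line r1 + r2 = a1 the dimension is a concave parabola in r1 with apex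
   at (a0 + a1 - a2) / 2, so its integer maximisers g1 satisfy
   |2 g1 - (a0 + a1 - a2)| <= 1. *)
Lemma dim_lt_balanced r1 r2 g1 g2 : feasible g1 g2 -> feasible r1 r2 ->
  (g1 + g2 = a1)%N ->
  `|g1%:Z * 2 - (a0%:Z + a1%:Z - a2%:Z)| <= 1 ->
  ~ ((r1 + r2)%N = a1 /\
     `|r1%:Z * 2 - (a0%:Z + a1%:Z - a2%:Z)| <= 1) ->
  (dimS r1 r2 < dimS g1 g2)%N.
Proof.
move=> /feasibleP[u [w [v [F0 F1 F2]]]] /feasibleP[x [t [y [E0 E1 E2]]]] g12 gmid rmid.
have w0 : w = 0%N by lia.
rewrite (stratum_dimE E0 E1 E2) (stratum_dimE F0 F1 F2) w0.
have {}gmid : `|v%:Z - u%:Z| <= 1 by lia.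
have {}rmid : ~ (t = 0%N /\ `|u%:Z + v%:Z - x%:Z * 2| <= 1).
  by move=> h; apply: rmid; lia.
have Et : t%:Z = x%:Z + y%:Z - u%:Z - v%:Z by lia.
have Eg1 : g1%:Z = r1%:Z + x%:Z - u%:Z by lia.
have Eg2 : g2%:Z = r2%:Z + y%:Z - v%:Z by lia.
rewrite -ltz_nat !PoszD !PoszM !PoszD Eg1 Eg2 -subr_gt0.
rewrite (_ : _ - _ = (v%:Z - x%:Z) * (u%:Z - x%:Z) + t%:Z * y%:Z); last by rewrite Et; ring.
have ty : 0 <= t%:Z * y%:Z by rewrite mulr_ge0.
have [xu|xu|xu] := ltgtP x u; have [xv|xv|xv] := ltgtP x v; try lia.
- by rewrite ltr_pwDl// mulr_gt0//; lia.
- by rewrite (_ : v%:Z - x%:Z = 0) ?mul0r ?add0r ?mulr_gt0; lia.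
- by rewrite ltr_pwDl// nmulr_lgt0; lia.
- by rewrite (_ : v%:Z - x%:Z = 0) ?mul0r ?add0r ?mulr_gt0; lia.
- by rewrite (_ : u%:Z - x%:Z = 0) ?mulr0 ?add0r ?mulr_gt0; lia.
- by rewrite (_ : u%:Z - x%:Z = 0) ?mulr0 ?add0r ?mulr_gt0; lia.
- by rewrite (_ : u%:Z - x%:Z = 0) ?mulr0 ?add0r ?mulr_gt0; lia.
Qed.

End MaximalStrata.

Theorem theorem3p2 (R : realType) (a0 a1 a2 : nat)
  (f : cspace R a0 a1 a2 -> R)
  (f_ge0 : forall x, 0 <= f x)
  (f_bounded : exists C : R, forall x, f x <= C)
  (f_borel : borel_fun f)
  (f_density : (0 < hintegral (@cc_dist R a0 a1 a2) (@Ndim a0 a1 a2)%:R setT f < +oo)%E)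
  (f_M_pos : (0 < hintegral (@cc_dist R a0 a1 a2) (@cdim R a0 a1 a2)
                      (@chain_complexes R a0 a1 a2) f)%E)
  (f_M_fin : (hintegral (@cc_dist R a0 a1 a2) (@cdim R a0 a1 a2)
                      (@chain_complexes R a0 a1 a2) f < +oo)%E) :
  let chi : int := a0%:Z - a1%:Z + a2%:Z in
  [/\ (a1 + a2 <= a0)%N ->
        almost_surely f (fun x => betti x = (a0%:Z - a1%:Z, 0, a2%:Z)),
      (a0 + a1 <= a2)%N ->
        almost_surely f (fun x => betti x = (a0%:Z, 0, a2%:Z - a1%:Z)),
      (a0 + a2 <= a1)%N ->
        almost_surely f (fun x => betti x = (0, a1%:Z - a0%:Z - a2%:Z, 0)),
      (a2%:Z - a1%:Z <= a0%:Z <= a1%:Z + a2%:Z) -> (a1 <= a0 + a2)%N ->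
        ~~ odd `|chi|%N ->
        almost_surely f (fun x => betti x = ((chi %/ 2)%Z, 0, (chi %/ 2)%Z)) &
      (a2%:Z - a1%:Z <= a0%:Z <= a1%:Z + a2%:Z) -> (a1 <= a0 + a2)%N ->
        odd `|chi|%N ->
        almost_surely f (fun x =>
          (betti x = (((chi + 1) %/ 2)%Z, 0, ((chi - 1) %/ 2)%Z)) \/
          (betti x = (((chi - 1) %/ 2)%Z, 0, ((chi + 1) %/ 2)%Z)))]
  /\ almost_surely f (fun x =>
        (betti x).1.1 + (betti x).1.2 + (betti x).2 = `|chi|%R).
Proof.
move=> chi.
have fM : (0 < hintegral (@cc_dist R a0 a1 a2) (@cdim R a0 a1 a2)
    (@chain_complexes R a0 a1 a2) f < +oo)%E by rewrite f_M_pos f_M_fin.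
have /andP[f0 _] := f_density.
have generic (P : cspace R a0 a1 a2 -> Prop) g1 g2 : feasible a0 a1 a2 g1 g2 ->
    (forall x, feasible a0 a1 a2 (\rank x.1) (\rank x.2) -> ~ P x ->
      (stratum_dim a0 a1 a2 (\rank x.1) (\rank x.2) < stratum_dim a0 a1 a2 g1 g2)%N) ->
    almost_surely f P.
  move=> g h; apply: (almost_surely_generic f0 fM g) => x Mx.
  by apply: h; exact: chain_complex_feasible.
have case_left (P : cspace R a0 a1 a2 -> Prop) : (a1 + a2 <= a0)%N ->
    (forall x, betti x = (a0%:Z - a1%:Z, 0, a2%:Z) -> P x) -> almost_surely f P.
  move=> le hP; apply: (generic _ a1 0%N) => [|x fx nPx]; first by rewrite /feasible; lia.
  apply: dim_lt_left => // -[h1 h2]; apply: nPx; apply: hP; rewrite /betti h1 h2.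
  by congr (_, _, _); lia.
have case_right (P : cspace R a0 a1 a2 -> Prop) : (a0 + a1 <= a2)%N ->
    (forall x, betti x = (a0%:Z, 0, a2%:Z - a1%:Z) -> P x) -> almost_surely f P.
  move=> le hP; apply: (generic _ 0%N a1) => [|x fx nPx]; first by rewrite /feasible; lia.
  apply: dim_lt_right => // -[h1 h2]; apply: nPx; apply: hP; rewrite /betti h1 h2.
  by congr (_, _, _); lia.
have case_middle (P : cspace R a0 a1 a2 -> Prop) : (a0 + a2 <= a1)%N ->
    (forall x, betti x = (0, a1%:Z - a0%:Z - a2%:Z, 0) -> P x) -> almost_surely f P.
  move=> le hP; apply: (generic _ a0 a2) => [|x fx nPx]; first by rewrite /feasible; lia.
  apply: dim_lt_middle => // -[h1 h2]; apply: nPx; apply: hP; rewrite /betti h1 h2.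
  by congr (_, _, _); lia.
have case_even (P : cspace R a0 a1 a2 -> Prop) :
    (a2%:Z - a1%:Z <= a0%:Z <= a1%:Z + a2%:Z) -> (a1 <= a0 + a2)%N -> ~~ odd `|chi|%N ->
    (forall x, betti x = ((chi %/ 2)%Z, 0, (chi %/ 2)%Z) -> P x) -> almost_surely f P.
  move=> le02 le1 ev hP.
  have [m Em] : exists m : nat, (a0 + a2 = a1 + m * 2)%N.
    by exists ((a0 + a2 - a1)./2); lia.
  have chim : (chi %/ 2)%Z = m%:Z.
    by rewrite (_ : chi = m%:Z * 2) ?mulzK// /chi; lia.
  apply: (generic _ (a0 - m)%N (a2 - m)%N) => [|x fx nPx]; first by rewrite /feasible; lia.
  apply: dim_lt_balanced => //; [by rewrite /feasible; lia|by lia|by lia|].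
  move=> [h1 h2]; apply: nPx; apply: hP; rewrite chim /betti.
  move: (\rank x.1) (\rank x.2) h1 h2 => r1 r2 h1 h2.
  by congr (_, _, _); lia.
have case_odd (P : cspace R a0 a1 a2 -> Prop) :
    (a2%:Z - a1%:Z <= a0%:Z <= a1%:Z + a2%:Z) -> (a1 <= a0 + a2)%N -> odd `|chi|%N ->
    (forall x, (betti x = (((chi + 1) %/ 2)%Z, 0, ((chi - 1) %/ 2)%Z)) \/
       (betti x = (((chi - 1) %/ 2)%Z, 0, ((chi + 1) %/ 2)%Z)) -> P x) ->
    almost_surely f P.
  move=> le02 le1 od hP.
  have [m Em] : exists m : nat, (a0 + a2 = a1 + (m * 2).+1)%N.
    by exists ((a0 + a2 - a1)./2); lia.
  have chim : ((chi - 1) %/ 2)%Z = m%:Z.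
    by rewrite (_ : chi - 1 = m%:Z * 2) ?mulzK// /chi; lia.
  have chim1 : ((chi + 1) %/ 2)%Z = m%:Z + 1.
    by rewrite (_ : chi + 1 = (m%:Z + 1) * 2) ?mulzK// /chi; lia.
  apply: (generic _ (a0 - m)%N (a2 - m.+1)%N) => [|x fx nPx]; first by rewrite /feasible; lia.
  apply: dim_lt_balanced => //; [by rewrite /feasible; lia|by lia|by lia|].
  move=> [h1 h2]; apply: nPx; apply: hP; rewrite chim chim1 /betti.
  move: (\rank x.1) (\rank x.2) h1 h2 => r1 r2 h1 h2.
  have [h|h] : r1%:Z = a0%:Z - m%:Z \/ r1%:Z = a0%:Z - m%:Z - 1 by lia.
    by right; congr (_, _, _); lia.
  by left; congr (_, _, _); lia.
split; first by split; eauto.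
have [le|lt0] := leqP (a1 + a2) a0.
  by apply: case_left => // x ->; rewrite /chi /=; lia.
have [le|lt2] := leqP (a0 + a1) a2.
  by apply: case_right => // x ->; rewrite /chi /=; lia.
have [le|lt1] := leqP (a0 + a2) a1.
  by apply: case_middle => // x ->; rewrite /chi /=; lia.
have [od|ev] := boolP (odd `|chi|%N).
  apply: case_odd => //; [lia|lia|move=> x [|] -> /=; rewrite /chi; lia].
apply: case_even => //; [lia|lia|move=> x -> /=; rewrite /chi; lia].
Qed.
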